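(* Let $G=(V,E)$ be a planar irreducible graph, let $D\subsetneq\mathbb{C}$ be a simply connected domain, and let $S(\cdot)$ be a natural random walk on $G$ (started at an arbitrary vertex), with exit time $\tau_D$ from $D$. Then for every finite sequence $\omega$, $$\mathbf{P}\big(L[(S(0),S(1),\dots,S(\tau_D))^-]=\omega\big)=\mathbf{P}\big(L[(S(0),S(1),\dots,S(\tau_D))]^-=\omega\big).$$
   Context: For $u,v\in\mathbb{C}$, $[u,v]$ is the closed line segment. $V\subset\mathbb{C}$ is countable with $0\in V$; $E:V\times V\to[0,\infty)$ is a weight function (not assumed symmetric) and a pair $(u,v)$ with $E(u,v)>0$ is called a (directed) edge; $\sum_{v}E(u,v)<\infty$ for all $u$, and $p(u,v)=E(u,v)/\sum_{w}E(u,w)$. $G=(V,E)$ is a planar irreducible graph if: (1) for all edges $(u,v),(u',v')$ with $\{u,v\}\neq\{u',v'\}$, $[u,v]\cap[u',v']\in\{\emptyset,\{u\},\{v\}\}$; (2) every compact subset of $\mathbb{C}$ contains finitely many vertices; (3) the Markov chain $S(\cdot)$ on $V$ with transition probability $p$ is irreducible. $S(\cdot)$ is called the natural random walk on $G$. $V(D)=V\cap D$; $\partial_{out}V(D)$ is the set of edges $(u,v)$ with $u\in V(D)$ and $[u,v]\cap\partial D\neq\emptyset$; $\partial_{in}V(D)$ is the set of edges $(u,v)$ with $v\in V(D)$ and $[u,v]\cap\partial D\ne\emptyset$. The exit time is $\tau_D=\inf\{n\ge1:(S(n-1),S(n))\in\partial_{out}V(D)\}$ if $S(0)\in V(D)$;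 $\tau_D=\inf\{n\ge2:(S(n-1),S(n))\in\partial_{out}V(D)\}$ if (otherwise) $(S(0),S(1))\in\partial_{in}V(D)$; and $\tau_D=0$ otherwise. The events are considered on $\{\tau_D<\infty\}$. When the walk exits through an edge in $\partial_{out}V(D)$, the exit point $S(\tau_D)$ is regarded as a boundary point, distinct from all elements of $V(D)$ (this matters only if an edge joining two vertices of $D$ crosses $\partial D$). Loop erasure: for $\omega=(\omega_0,\dots,\omega_n)$ put $s_0=\max\{k\ge0:\omega_k=\omega_0\}$, inductively $s_m=\max\{k\ge0:\omega_k=\omega_{s_{m-1}+1}\}$, and $l=\min\{m\ge0:\omega_{s_m}=\omega_n\}$; then $L[\omega]=(\omega_{s_0},\omega_{s_1},\dots,\omega_{s_l})$. Time reversal: $\omega^-=(\omega_n,\omega_{n-1},\dots,\omega_0)$. *)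

(* Defs.v *)
From HB Require Import structures.
From mathcomp Require Import all_boot all_order all_algebra.
From mathcomp Require Import complex.
From mathcomp Require Import all_classical all_reals all_analysis.

Set Implicit Arguments.
Unset Strict Implicit.
Unset Printing Implicit Defensive.

Import Order.TTheory GRing.Theory Num.Theory.
Import numFieldNormedType.Exports.

Local Open Scope classical_set_scope.
Local Open Scope complex_scope.
Local Open Scope ring_scope.

(** The complex numbers over [R]; the regular-algebra alias [^o] is what carries
    the topology given by the modulus. *)
Notation plane R := (R[i]%C)^o.

Section Plane.
Context {R : realType}.
Implicit Types (D : set (plane R)) (u v : plane R).

Definition segment u v : set (plane R) :=
  [set u + t%:C * (v - u) | t in `[0, 1]].

Definition boundary D : set (plane R) := closure D `\` interior D.

Definition domain D : Prop := [/\ open D, connected D & D !=set0].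

(** Every loop in [D] contracts inside [D], with fixed base point. *)
Definition loops_contractible D : Prop :=
  forall gamma : R -> plane R,
    {within `[0, 1], continuous gamma} ->
    (forall s : R, s \in `[0, 1] -> D (gamma s)) ->
    gamma 0 = gamma 1 ->
    exists H : R * R -> plane R,
      [/\ {within `[0, 1] `*` `[0, 1], continuous H},
          forall s t : R, s \in `[0, 1] -> t \in `[0, 1] -> D (H (s, t)),
          forall s : R, s \in `[0, 1] -> H (s, 0) = gamma s,
          forall s : R, s \in `[0, 1] -> H (s, 1) = gamma 0 &
          forall t : R, t \in `[0, 1] -> H (0, t) = gamma 0 /\ H (1, t) = gamma 0].

Definition simply_connected_domain D : Prop :=
  domain D /\ loops_contractible D.

End Plane.

(** Points of stopped walks: [inl z] is the vertex [z]; [inr z] is the boundary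
    point reached when the walk exits [D] through an edge whose head [z] is
    itself in [D]: it differs from every vertex of [D]. *)
Notation walk_point R := (plane R + plane R)%type.

(** In the sequel only the values of [E] on [V * V] matter. *)
Section Graph.
Context {R : realType}.
Variables (V : set (plane R)) (E : plane R -> plane R -> R).

Definition edge (u v : plane R) : Prop := [/\ V u, V v & 0 < E u v].

Definition total_weight (u : plane R) : \bar R := \esum_(v in V) (E u v)%:E.

Definition trans_prob (u v : plane R) : R := E u v / fine (total_weight u).

Fixpoint trans_prob_n (n : nat) (u v : plane R) : \bar R :=
  if n is m.+1
  then \esum_(w in V) ((trans_prob u w)%:E * trans_prob_n m w v)%E
  else (u == v)%:R%:E.

(** Positivity of [total_weight] is what makes [trans_prob] a transition
    probability. *)
Record planar_irreducible_graph : Prop := PlanarIrreducibleGraph {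
  vertices_countable : countable V;
  vertices_0 : V 0;
  weight_ge0 : forall u v, V u -> V v -> 0 <= E u v;
  total_weight_gt0 : forall u, V u -> (0 < total_weight u)%E;
  total_weight_fin : forall u, V u -> (total_weight u < +oo)%E;
  graph_planar : forall u v u' v', edge u v -> edge u' v' ->
    [set u; v] <> [set u'; v'] ->
    [\/ segment u v `&` segment u' v' = set0,
        segment u v `&` segment u' v' = [set u] |
        segment u v `&` segment u' v' = [set v]];
  graph_locally_finite : forall K : set (plane R),
    compact K -> finite_set (V `&` K);
  graph_irreducible : forall u v, V u -> V v ->
    exists n, (0 < trans_prob_n n u v)%E
}.

(** The Markov property is stated multiplicatively, so as not to condition on
    null events. *)
Record natural_random_walk d (T : measurableType d) (P : probability T R)
    (x : plane R) (S : nat -> T -> plane R) : Prop := NaturalRandomWalk {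
  walk_vertex : forall n t, V (S n t);
  walk_measurable : forall n v, measurable [set t | S n t = v];
  walk_start : P [set t | S 0%N t = x] = 1%E;
  walk_markov : forall (n : nat) (w : nat -> plane R), (forall k, V (w k)) ->
    P [set t | forall k, (k <= n.+1)%N -> S k t = w k] =
    (P [set t | forall k, (k <= n)%N -> S k t = w k]
       * (trans_prob (w n) (w n.+1))%:E)%E
}.

Variable D : set (plane R).

Definition out_edge (u v : plane R) : Prop :=
  [/\ edge u v, (V `&` D) u & segment u v `&` boundary D !=set0].

Definition in_edge (u v : plane R) : Prop :=
  [/\ edge u v, (V `&` D) v & segment u v `&` boundary D !=set0].

(** The infimum of [A] in the natural numbers, [None] standing for infinity. *)
Definition inf_time (A : set nat) : option nat :=
  match pselect (exists n, n \in A) with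
  | left h => Some (ex_minn h)
  | right _ => None
  end.

Definition exit_time (s : nat -> plane R) : option nat :=
  if s 0%N \in V `&` D then
    inf_time [set n | (1 <= n)%N /\ out_edge (s n.-1) (s n)]
  else if `[< in_edge (s 0%N) (s 1%N) >] then
    inf_time [set n | (2 <= n)%N /\ out_edge (s n.-1) (s n)]
  else Some 0%N.

Definition exit_point (z : plane R) : walk_point R :=
  if z \in V `&` D then inr z else inl z.

(** [(s 0, ..., s n)], where [n] is the exit time. *)
Definition stopped_walk (s : nat -> plane R) (n : nat) : seq (walk_point R) :=
  rcons [seq inl (s k) | k <- iota 0%N n] (exit_point (s n)).

End Graph.

Section LoopErasure.
Context {X : eqType}.
Implicit Types (x : X) (w : seq X).

(** The largest [k] with [w_k = x]; [x0] is a junk default for [nth]. *)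
Definition last_visit (x0 : X) w x : nat :=
  \max_(k < size w | nth x0 w k == x) k.

Fixpoint erasure_time (x0 : X) w (m : nat) : nat :=
  if m is m'.+1
  then last_visit x0 w (nth x0 w (erasure_time x0 w m').+1)
  else last_visit x0 w (nth x0 w 0%N).

(** The minimal [m] below [size w] always exists, as the times [erasure_time]
    increase strictly until the last one, [(size w).-1], is reached. *)
Definition erasure_length (x0 : X) w : nat :=
  find (fun m => nth x0 w (erasure_time x0 w m) == nth x0 w (size w).-1)
       (iota 0%N (size w)).

Definition loop_erasure w : seq X :=
  if w is x0 :: _ then
    [seq nth x0 w (erasure_time x0 w m) | m <- iota 0%N (erasure_length x0 w).+1]
  else [::].

End LoopErasure.

(* Main.v *)
Require Import Defs.
From HB Require Import structures.
From mathcomp Require Import all_boot all_order all_algebra.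
From mathcomp Require Import zify complex.
From mathcomp Require Import all_classical all_reals all_analysis.

(** Cut a path at the successive last visits that define its loop erasure [eta]:
    it becomes the concatenation of loops based at the entries of [eta], where
    the loop at each entry avoids all the previous entries. In the same way, the
    loop erasure of the reversed path is the reversal of [eta] if and only if the
    path is a concatenation of loops based at the entries of [eta] where each
    loop avoids all the later entries ([loop_erasure_walk_of] and
    [backward_reverse_loops]).

    One family is turned into the other by a local exchange. Given a loop at [x]
    and a loop at [y] that avoids [x], one may cut the part of the first loop
    between a visit of [x] and its end, rotate it so that it is based at [y], and
    append it to the second loop, in such a way that the first loop then avoids
    [y] ([swap_loops]). The multiset of oriented steps does not change, and the
    original pair can be recovered. Doing this for all pairs of entries yields an
    injection of the paths with loop erasure [eta] into the paths whose reversal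
    has the reversed loop erasure, preserving the initial point and the multiset
    of steps ([exists_reversing_rearrangement]). Conjugating it with time reversal
    gives an injection in the opposite direction.

    The probability that the stopped walk is a given path, if it can be at all, is
    the probability of the initial point times the product of the transition
    probabilities of the steps, so that it does not change under such a
    rearrangement. Moreover, a path along edges is a possible stopped walk as soon
    as a rearrangement of it is one, because the end point occurs only once and
    the other requirements concern individual steps ([exit_path_rearranged]); here
    the end point must differ from the initial one. As there are countably many
    paths, each injection gives one inequality between the two probabilities
    ([stop_events_le]). When the prescribed sequence has at most one entry, the end
    points may agree, but then the two events are equal. *)

Import Order.TTheory GRing.Theory Num.Theory.
Import numFieldNormedType.Exports.

Set Implicit Arguments.
Unset Strict Implicit.
Unset Printing Implicit Defensive.

(** * Exchanging two loops *)

Section Splitting.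
Context {X : eqType}.
Implicit Types (x y : X) (s a b : seq X).

Definition upto_last x s := take (size s - index x (rev s)) s.
Definition past_last x s := drop (size s - index x (rev s)) s.

Lemma cat_upto_last x s : upto_last x s ++ past_last x s = s.
Proof. exact: cat_take_drop. Qed.

Lemma last_upto_last x s : last x (upto_last x s) = x.
Proof.
elim/last_ind: s => [|s y IHs]; first by [].
rewrite /upto_last rev_rcons size_rcons /=; case: eqP => [->|_].
  by rewrite subn0 -(size_rcons s x) take_size last_rcons.
by rewrite subSS -cats1 takel_cat ?leq_subr.
Qed.

Lemma past_last_notin x s : x \notin past_last x s.
Proof.
elim/last_ind: s => [|s y IHs]; first by [].
rewrite /past_last rev_rcons size_rcons /=; case: eqP => [->|/eqP neq_yx].
  by rewrite subn0 -(size_rcons s x) drop_size.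
by rewrite subSS drop_rcons ?leq_subr // mem_rcons inE negb_or eq_sym neq_yx.
Qed.

(** The cut after [a] is the last visit of [y] before the first visit of [x], so
    it can be read off the concatenation; this is what makes the exchange of
    two loops reversible. *)
Lemma split_unique x y a b a' b' : a ++ b = a' ++ b' ->
  last y a = y -> x \notin a -> y \notin take (index x b) b ->
  last y a' = y -> x \notin a' -> y \notin take (index x b') b' ->
  a = a' /\ b = b'.
Proof.
wlog le_aa' : a b a' b' / size a <= size a'.
  move=> H E *; case/orP: (leq_total (size a) (size a')) => le_aa'; first exact: H.
  by case: (H a' b' a b) => // -> ->.
move=> E _ _ yb la' xa' _; set m := drop (size a) a'.
have Ea : a' = a ++ m.
  by rewrite -[LHS](cat_take_drop (size a)) -/m -(takel_cat b' le_aa') -E take_size_cat.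
have Eb : b = m ++ b'.
  by move/eqP: E; rewrite Ea -catA eqseq_cat // eqxx => /eqP.
move: la' xa' yb; rewrite Ea Eb last_cat mem_cat negb_or index_cat.
move: m {Ea Eb E} => m + /andP[_ /negPf xm]; rewrite xm take_cat ltnNge leq_addr addKn.
rewrite mem_cat negb_or; case/lastP: m {xm} => [|m z]; first by rewrite cats0.
by rewrite last_rcons => ->; rewrite mem_rcons mem_head.
Qed.

End Splitting.

Section Walks.
Context {X : eqType}.
Implicit Types (x y : X) (c p : seq X) (ls : seq (X * seq X)).

Definition steps p : seq (X * X) := if p is x :: s then pairmap pair x s else [::].

(** Rearranged paths have the same weight under every Markov chain. *)
Definition rearranged p p' := ohead p = ohead p' /\ perm_eq (steps p) (steps p').

Lemma unzip1_steps x s : unzip1 (steps (x :: s)) = belast x s.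
Proof. by elim: s x => //= y s IHs x; rewrite -(IHs y). Qed.

Lemma unzip2_steps x s : unzip2 (steps (x :: s)) = s.
Proof. by elim: s x => //= y s IHs x; congr cons; apply: IHs. Qed.

Lemma steps_rcons s y z :
  steps (rcons (rcons s y) z) = rcons (steps (rcons s y)) (y, z).
Proof.
case: s => //= x s.
by rewrite -!cats1 !pairmap_cat /= last_cat /= -catA.
Qed.

Lemma steps_rev p : steps (rev p) = rev [seq (e.2, e.1) | e <- steps p].
Proof.
case: p => // x s; elim: s x => // y s IHs x.
have -> : steps [:: x, y & s] = (x, y) :: steps (y :: s) by [].
by rewrite 2!rev_cons steps_rcons -rev_cons IHs map_cons rev_cons.
Qed.

(** The heads of the steps give all points but the first one, their tails all
    points but the last one; comparing the two multisets determines the last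
    point. *)
Lemma rearranged_belast x s x' s' : rearranged (x :: s) (x' :: s') ->
  [/\ x' = x, perm_eq s s', perm_eq (belast x s) (belast x' s') &
      last x s = last x' s'].
Proof.
case=> [[<-] Hp]; have P2 : perm_eq s s'.
  by rewrite -(unzip2_steps x s) -(unzip2_steps x s'); apply: perm_map.
have P1 : perm_eq (belast x s) (belast x s').
  by rewrite -!unzip1_steps; apply: perm_map.
split=> //; have : perm_eq (x :: s) (x :: s') by rewrite perm_cons.
rewrite !lastI -!cats1.
rewrite (permPr (_ : perm_eq _ (belast x s ++ [:: last x s']))); last first.
  by rewrite perm_cat2r perm_sym.
by rewrite perm_cat2l => /perm_small_eq /= /(_ isT) [].
Qed.

Lemma rearranged_rev p p' : rearranged p p' -> rearranged (rev p) (rev p').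
Proof.
case: p p' => [|x s] [|x' s'] // H; first by case: H.
  by case: H.
split; last by rewrite !steps_rev perm_rev perm_sym perm_rev perm_sym perm_map; case: H.
have [_ _ _ E] := rearranged_belast H.
by rewrite !lastI !rev_rcons /= E.
Qed.

Section Swap.
Variables x y : X.

(** Here [cx] and [cy] are the tails of a loop at [x] and of a loop at [y] that
    avoids [x]. If the first loop visits [y], it is cut as [a ++ c1 ++ c2]:
    [a] ends at the last visit of [x] before the first visit of [y], [c1] ends
    at the last visit of [y], and [c2] goes back to [x]. Then [c2 ++ c1] is a
    loop based at [y], which is transferred to the end of the loop at [y]; what
    remains at [x] avoids [y]. *)
Definition swap_loops (cx cy : seq X) : seq X * seq X :=
  if y \in cx then
    let a := upto_last x (take (index y cx) cx) in
    let r := drop (size a) cx in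
    (a, cy ++ past_last y r ++ upto_last y r)
  else (cx, cy).

Variant swap_spec cx cy : seq X * seq X -> Prop :=
| SwapId of y \notin cx : swap_spec cx cy (cx, cy)
| SwapCut a c1 c2 of cx = a ++ c1 ++ c2 & last x a = x & y \notin a
    & last x c1 = y & y \in c1 & x \notin take (index y c1) c1
    & last y c2 = x & x \in c2 & y \notin c2 :
    swap_spec cx cy (a, cy ++ c2 ++ c1).

Lemma swap_loopsP cx cy : x != y -> last x cx = x ->
  swap_spec cx cy (swap_loops cx cy).
Proof.
move=> neq_xy lx; rewrite /swap_loops; cbv zeta.
case: ifPn => [ycx|]; last by left.
set pre := take _ cx; set a := upto_last x pre; set r := drop (size a) cx.
have Epre : a ++ past_last x pre = pre := cat_upto_last x pre.
have ypre : y \notin pre by rewrite -has_pred1 has_take_leq ?index_size // ltnn.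
have E : cx = a ++ (past_last x pre ++ drop (index y cx) cx).
  by rewrite catA Epre cat_take_drop.
have Er : r = past_last x pre ++ y :: drop (index y cx).+1 cx.
  by rewrite -(drop_index ycx) /r [X in drop _ X = _]E drop_size_cat.
have Ecx : cx = a ++ r by rewrite [LHS]E Er (drop_index ycx).
set c1 := upto_last y r; set c2 := past_last y r.
have Ec : c1 ++ c2 = r := cat_upto_last y r.
have la : last x a = x := last_upto_last x pre.
have lc1 : last y c1 = y := last_upto_last y r.
have yc2 : y \notin c2 := past_last_notin y r.
have yc1 : y \in c1.
  have: y \in r by rewrite Er mem_cat mem_head orbT.
  by rewrite -[X in y \in X -> _]Ec mem_cat (negPf yc2) orbF.
have /andP[ya yp] : (y \notin a) && (y \notin past_last x pre).
  by rewrite -negb_or -mem_cat Epre.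
have xc1 : x \notin take (index y c1) c1.
  have <- : take (index y r) r = take (index y c1) c1.
    by rewrite -Ec index_cat yc1 takel_cat ?index_size.
  by rewrite Er index_cat (negPf yp) /= eqxx addn0 take_size_cat // past_last_notin.
have lc1x : last x c1 = y by move: lc1 yc1; case: (c1).
have {}lx : last y c2 = x by move: lx; rewrite Ecx -Ec !last_cat la lc1x.
apply: SwapCut => //; first by rewrite Ec.
by have := mem_last y c2; rewrite lx inE (negPf neq_xy).
Qed.

Lemma swap_loops_perm cx cy : x != y -> last x cx = x -> last y cy = y ->
  let c := swap_loops cx cy in
  [/\ last x c.1 = x, last y c.2 = y, y \notin c.1,
      perm_eq (cx ++ cy) (c.1 ++ c.2) &
      perm_eq (steps (x :: cx) ++ steps (y :: cy))
              (steps (x :: c.1) ++ steps (y :: c.2))].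
Proof.
move=> neq_xy lx ly; case: swap_loopsP => // a c1 c2 -> la ya lc1x yc1 _ lc2 xc2 _ /=.
rewrite !last_cat ly lc2 lc1x; split=> //.
  by apply/permP => f; rewrite !count_cat; lia.
by apply/permP => f; rewrite !pairmap_cat la lc1x ly lc2 !count_cat; lia.
Qed.

(** The visits of [x] in the new loop at [y] tell the two cases apart, and both
    cuts of [cy ++ c2 ++ c1] are recovered by [split_unique], the second one with
    the roles of [x] and [y] exchanged. *)
Lemma swap_loops_inj cx cy dx dy : x != y ->
  last x cx = x -> last y cy = y -> x \notin cy ->
  last x dx = x -> last y dy = y -> x \notin dy ->
  swap_loops cx cy = swap_loops dx dy -> cx = dx /\ cy = dy.
Proof.
move=> neq_xy lcx lcy xcy ldx ldy xdy.
have notin_take (u v : X) s t : u \in s -> v \notin s ->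
    v \notin take (index u (s ++ t)) (s ++ t).
  move=> us vs; rewrite index_cat us takel_cat ?index_size //.
  by apply: contra vs; apply: mem_take.
case: swap_loopsP => // [_|a c1 c2 -> la ya lc1 yc1 xc1 lc2 xc2 yc2];
  case: swap_loopsP => // [_|b d1 d2 -> lb yb ld1 yd1 xd1 ld2 xd2 yd2].
- by case.
- by case=> _ E; move: xcy; rewrite E !mem_cat xd2 orbT.
- by case=> _ E; move: xdy; rewrite -E !mem_cat xc2 orbT.
case=> <- /(@split_unique _ x y) []; rewrite ?notin_take // => ->.
case/(@split_unique _ y x); rewrite //; last by move=> -> ->.
  by move: lc2 xc2; case: (c2).
by move: ld2 xd2; case: (d2).
Qed.

End Swap.

(** * Reordering the loops of a path *)

Definition avoids (A : seq X) := all [predC A].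

(** A pair [(x, c)] stands for the loop [x :: c] at [x], trivial if [c] is
    empty; a path is a list of loops, travelled one after the other. *)
Definition walk_of ls : seq X := flatten [seq l.1 :: l.2 | l <- ls].

Definition loop_avoiding (A : seq X) x c := (last x c == x) && avoids A (x :: c).

(** The decompositions at last visits: each loop avoids the base points of the
    loops before it, which are accumulated in [A]. *)
Fixpoint forward (A : seq X) ls :=
  if ls is (x, c) :: ls' then loop_avoiding A x c && forward (x :: A) ls' else true.

(** The decompositions at first visits, which are those of the reversed path:
    each loop avoids the base points of the loops after it. *)
Fixpoint backward (A : seq X) ls :=
  if ls is (x, c) :: ls' then
    loop_avoiding (unzip1 ls' ++ A) x c && backward A ls'
  else true.

Definition loop_steps ls := flatten [seq steps (l.1 :: l.2) | l <- ls].

(** The loop [x :: c] precedes [ls] and has to be freed from the base points of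
    [ls], while those loops no longer need to avoid [x]. It is exchanged with the
    last loop first: when the turn of [y] comes, the loop at [x] already avoids all
    the base points after [y], and so does the part that it leaves at [y]. *)
Fixpoint move_loop x c ls : seq X * seq (X * seq X) :=
  if ls is (y, cy) :: ls' then
    let m := move_loop x c ls' in
    let s := swap_loops x y m.1 cy in
    (s.1, (y, s.2) :: m.2)
  else (c, [::]).

Fixpoint reorder ls :=
  if ls is (x, c) :: ls' then
    let m := move_loop x c (reorder ls') in (x, m.1) :: m.2
  else [::].

Lemma avoids_perm A c d : perm_eq c d -> avoids A c = avoids A d.
Proof. by move=> /perm_mem H; apply: eq_all_r. Qed.

Lemma avoids_cat A B c : avoids (A ++ B) c = avoids A c && avoids B c.
Proof. by rewrite /avoids -all_predI; apply: eq_all => z; rewrite /= mem_cat negb_or. Qed.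

Lemma avoids_mem A B c : A =i B -> avoids A c = avoids B c.
Proof. by move=> eqAB; apply: eq_all => z; rewrite /= eqAB. Qed.

Lemma avoids_cons x A c : avoids (x :: A) c = (x \notin c) && avoids A c.
Proof.
rewrite -cat1s avoids_cat; congr (_ && _); elim: c => //= y c ->.
by rewrite !inE negb_or eq_sym.
Qed.

(** The transfer between [x] and [y] neither creates nor destroys visits, so any
    point avoided by both loops stays avoided by both. *)
Lemma move_loopP A x c ls :
  backward (x :: A) ls -> loop_avoiding A x c -> x \notin unzip1 ls ->
  let m := move_loop x c ls in
  [/\ unzip1 m.2 = unzip1 ls, backward A ((x, m.1) :: m.2) &
      perm_eq (loop_steps ((x, c) :: ls)) (loop_steps ((x, m.1) :: m.2))].
Proof.
elim: ls => [|[y cy] ls IHls] /=; first by move=> _ ->.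
case/andP=> /andP[/eqP ly avy] bls lc; rewrite inE negb_or => /andP[neq_xy xls].
have [Eu] := IHls bls lc xls; set m := move_loop x c ls in Eu *.
rewrite /= {1}/loop_avoiding Eu => /andP[/andP[/eqP lm avm] bm] Pm.
have [] := swap_loops_perm neq_xy lm ly.
set s := swap_loops x y m.1 cy; move=> l1 l2 ym Pe Ps.
have : avoids (x :: unzip1 ls ++ A) (y :: cy).
  by rewrite -(avoids_mem (A := unzip1 ls ++ x :: A)) // => z;
     rewrite !(mem_cat, inE) orbCA.
rewrite avoids_cons => /andP[_ /= /andP[yB avy']].
move: avm => /= /andP[xB avm].
have : avoids (unzip1 ls ++ A) (s.1 ++ s.2).
  by rewrite -(avoids_perm _ Pe) /avoids all_cat; apply/andP.
rewrite /avoids all_cat => /andP[av1 av2].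
split=> //.
  rewrite /loop_avoiding l1 l2 !eqxx -cat_cons avoids_cons /avoids /= xB yB av1 av2 bm.
  by rewrite inE negb_or eq_sym neq_xy ym.
rewrite perm_catCA (permPl (_ : perm_eq _ (steps (y :: cy) ++ loop_steps ((x, m.1) :: m.2)))).
  rewrite [loop_steps _]/(_ ++ loop_steps m.2) catA.
  by rewrite [X in perm_eq _ X]catA perm_cat2r perm_catC.
by rewrite perm_cat2l.
Qed.

Lemma move_loop_inj A x c d ls ks :
  backward (x :: A) ls -> loop_avoiding A x c -> x \notin unzip1 ls ->
  backward (x :: A) ks -> loop_avoiding A x d -> unzip1 ls = unzip1 ks ->
  move_loop x c ls = move_loop x d ks -> c = d /\ ls = ks.
Proof.
elim: ls ks => [|[y cy] ls IHls] [|[z dy] ks] //=; first by move=> _ _ _ _ _ _ [->].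
move=> /andP[ly bls] lc; rewrite inE negb_or => /andP[neq_xy xls].
move=> /andP[lz bks] ld [Eyz Eu]; subst z; case.
have xks : x \notin unzip1 ks by rewrite -Eu.
have := move_loopP bls lc xls; have := move_loopP bks ld xks.
case: (move_loop x c ls) (IHls ks bls lc xls bks ld Eu) => c' ls'.
case: (move_loop x d ks) => d' ks' /= IH [_ /andP[/andP[/eqP ld' _] _] _].
move=> [_ /andP[/andP[/eqP lc' _] _] _].
have notin_loop B cy' u : loop_avoiding (B ++ x :: A) u cy' -> last u cy' = u /\ x \notin cy'.
  case/andP=> /eqP-> /= /andP[_ H]; split=> //; apply/negP => /(allP H) /=.
  by rewrite mem_cat mem_head orbT.
case: (notin_loop _ _ _ ly) (notin_loop _ _ _ lz) => lcy xcy [ldy xdy] E1 E2 E3.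
have [E4 ->] : c' = d' /\ cy = dy.
  by apply: (swap_loops_inj neq_xy) => //; rewrite [LHS]surjective_pairing [RHS]surjective_pairing E1 E2.
by case: IH => [|-> ->]; rewrite ?E4 ?E3.
Qed.

Lemma forward_notin A ls x : forward A ls -> x \in A -> x \notin unzip1 ls.
Proof.
elim: ls A => //= -[y d] ls IHls A /andP[/andP[_ /= /andP[yA _]] fls] xA.
rewrite inE negb_or (IHls _ fls) ?inE ?xA ?orbT // andbT.
by apply: contraNneq yA => <-.
Qed.

Lemma reorderP A ls : forward A ls ->
  [/\ unzip1 (reorder ls) = unzip1 ls, backward A (reorder ls) &
      perm_eq (loop_steps ls) (loop_steps (reorder ls))].
Proof.
elim: ls A => //= -[x c] ls IHls A /andP[lc] fls.
have [Eu bls Pls] := IHls _ fls.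
have xls : x \notin unzip1 (reorder ls) by rewrite Eu (forward_notin fls) ?mem_head.
have [Em bm Pm] := move_loopP bls lc xls.
split=> //=; first by rewrite Em Eu.
apply: perm_trans Pm; rewrite /loop_steps /=.
by rewrite perm_cat2l.
Qed.

Lemma reorder_inj A ls ks : forward A ls -> forward A ks ->
  unzip1 ls = unzip1 ks -> reorder ls = reorder ks -> ls = ks.
Proof.
elim: ls ks A => [|[x c] ls IHls] [|[y d] ks] A //= /andP[lc fls] /andP[ld fks].
case=> Exy Eu; subst y; have [E1 b1 _] := reorderP fls; have [E2 b2 _] := reorderP fks.
have nx l : unzip1 l = unzip1 ls -> x \notin unzip1 l.
  by move=> ->; rewrite (forward_notin fls) ?mem_head.
case=> E3 E4; have [] := move_loop_inj b1 lc _ b2 ld.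
- exact: nx.
- by rewrite E1 E2.
- by rewrite [LHS]surjective_pairing [RHS]surjective_pairing E3 E4.
by move=> -> /(IHls _ _ fls fks Eu) ->.
Qed.

End Walks.

Local Open Scope classical_set_scope.
Local Open Scope ring_scope.

(** * Loop erasure and its reversal *)

Section Decompositions.
Context {X : eqType}.
Implicit Types (x y : X) (c p : seq X) (ls : seq (X * seq X)).

Lemma walk_of_cat ls ks : walk_of (ls ++ ks) = walk_of ls ++ walk_of ks.
Proof. by rewrite /walk_of map_cat flatten_cat. Qed.

(** Besides the steps of its loops, a path makes exactly the steps of its
    sequence of base points, which reordering the loops leaves alone. *)
Lemma steps_walk_of x c ls : backward [::] ((x, c) :: ls) \/ forward [::] ((x, c) :: ls) ->
  perm_eq (steps (walk_of ((x, c) :: ls)))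
          (loop_steps ((x, c) :: ls) ++ steps (x :: unzip1 ls)).
Proof.
move=> wf; have {wf} : all (fun l => last l.1 l.2 == l.1) ((x, c) :: ls).
  case: wf; move: (_ :: ls) [::] => {x c} ks A.
    by elim: ks => //= -[y d] ks IH /andP[/andP[-> _] /IH].
  by elim: ks A => //= -[y d] ks IH A /andP[/andP[-> _] /IH].
elim: ls x c => [|[y d] ls IHls] x c; first by rewrite /walk_of /loop_steps /= !cats0.
move=> /= /andP[/eqP lx H].
have := IHls y d H; rewrite /walk_of /loop_steps -/(walk_of _) -/(loop_steps _) /=.
move=> Hp; rewrite pairmap_cat lx /=.
apply/permP => f; move/permP/(_ f): Hp; rewrite /= !count_cat /=; lia.
Qed.

Lemma forward_walk_notin A ls x : forward A ls -> x \in A -> x \notin walk_of ls.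
Proof.
elim: ls A => //= -[y d] ls IHls A /andP[/andP[_ avA] fls] xA.
rewrite /walk_of /= -cat_cons mem_cat negb_or -/(walk_of ls) (IHls _ fls) ?inE ?xA ?orbT //.
by rewrite andbT; apply/negP => /(allP avA); rewrite /= xA.
Qed.

Lemma forward_uniq A ls : forward A ls -> uniq (unzip1 ls).
Proof.
elim: ls A => //= -[y d] ls IHls A /andP[_ fls].
by rewrite /= (forward_notin fls) ?mem_head // (IHls _ fls).
Qed.

(** Cut off the loop that ends at the last visit of the first point, and recurse
    on the rest. *)
Lemma forward_decomposition p : exists ls, forward [::] ls /\ walk_of ls = p.
Proof.
suff H A : avoids A p -> exists ls, forward A ls /\ walk_of ls = p.
  by apply: H; apply/allP.
have [n] := ubnP (size p); elim: n p A => // n IHn [|x s] A; first by exists [::].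
move=> /ltnSE le_sn; rewrite /avoids -[s](cat_upto_last x) -cat_cons all_cat => /andP[av1 av2].
have [||ls [fls Els]] := IHn (past_last x s) (x :: A).
- by rewrite (leq_trans _ le_sn) // size_drop ltnS leq_subr.
- by rewrite avoids_cons past_last_notin.
exists ((x, upto_last x s) :: ls); rewrite /= fls /loop_avoiding /avoids last_upto_last eqxx av1.
by split=> //; rewrite /walk_of /= -/(walk_of ls) Els.
Qed.

Lemma last_visit_last x0 s1 z s2 : z \notin s2 ->
  last_visit x0 (s1 ++ z :: s2) z = size s1.
Proof.
move=> zs2; rewrite /last_visit; apply/eqP; rewrite eqn_leq; apply/andP; split.
  apply/bigmax_leqP => -[i /= lt_i]; rewrite nth_cat; case: ltnP => [/ltnW//|le_si] /eqP.
  rewrite size_cat /= in lt_i.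
  case E: (i - size s1)%N => [|j] /= Ez; first by lia.
  by case/negP: zs2; rewrite -Ez mem_nth //; lia.
have lt_s : (size s1 < size (s1 ++ z :: s2))%N by rewrite size_cat /=; lia.
apply: (@leq_bigmax_cond _ (fun k : 'I__ => nth x0 (s1 ++ z :: s2) k == z)
  (fun k => k : nat) (Ordinal lt_s)).
by rewrite /= nth_cat ltnn subnn.
Qed.

Lemma forward_cat A ls ks : forward A (ls ++ ks) =
  forward A ls && forward (rev (unzip1 ls) ++ A) ks.
Proof.
elim: ls A => //= -[x c] ls IHls A.
by rewrite IHls rev_cons cat_rcons andbA.
Qed.

Section Blocks.
Variables (x0 z : X) (ls1 : seq (X * seq X)) (c : seq X) (ls2 : seq (X * seq X)).
Let ls := ls1 ++ (z, c) :: ls2.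
Hypothesis fls : forward [::] ls.

Let walk_ofE : walk_of ls = (walk_of ls1 ++ belast z c) ++ z :: walk_of ls2.
Proof.
move: fls; rewrite forward_cat /= => /andP[_ /andP[/andP[/eqP lz _] _]].
rewrite walk_of_cat [walk_of (_ :: _)]/(_ ++ _) /= -cat_cons lastI lz.
by rewrite cat_rcons catA.
Qed.

Lemma last_visit_block :
  last_visit x0 (walk_of ls) z = (size (walk_of ls1) + size c)%N.
Proof.
rewrite walk_ofE last_visit_last ?size_cat ?size_belast //.
move: fls; rewrite forward_cat /= => /andP[_ /andP[_ f2]].
by rewrite (forward_walk_notin f2) ?mem_head.
Qed.

Lemma nth_block_start : nth x0 (walk_of ls) (size (walk_of ls1)) = z.
Proof. by rewrite walk_of_cat nth_cat ltnn subnn. Qed.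

Lemma nth_block_end : nth x0 (walk_of ls) (size (walk_of ls1) + size c) = z.
Proof. by rewrite walk_ofE nth_cat size_cat size_belast ltnn subnn. Qed.

End Blocks.

(** The base point of a loop is not visited after this loop, so its last visit is
    the end of the loop, and the next point is the next base point. *)
Lemma erasure_time_walk_of x0 ls1 z c ls2 : forward [::] (ls1 ++ (z, c) :: ls2) ->
  erasure_time x0 (walk_of (ls1 ++ (z, c) :: ls2)) (size ls1) =
  (size (walk_of ls1) + size c)%N.
Proof.
elim/last_ind: ls1 z c ls2 => [|ls1 [y d] IH] z c ls2 fls.
  by rewrite -(last_visit_block x0 fls).
rewrite size_rcons /=.
have -> : (erasure_time x0 (walk_of (rcons ls1 (y, d) ++ (z, c) :: ls2))
    (size ls1)).+1 = size (walk_of (rcons ls1 (y, d))).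
  rewrite cat_rcons in fls *; rewrite IH //.
  by rewrite -cats1 walk_of_cat size_cat /walk_of /= cats0 /= addnS.
by rewrite nth_block_start last_visit_block.
Qed.

Lemma loop_erasure_walk_of ls : forward [::] ls ->
  loop_erasure (walk_of ls) = unzip1 ls.
Proof.
case Els: ls => [//|[x0 c0] ks] fls; rewrite -Els in fls *.
have -> : loop_erasure (walk_of ls) =
   [seq nth x0 (walk_of ls) (erasure_time x0 (walk_of ls) m)
     | m <- iota 0%N (erasure_length x0 (walk_of ls)).+1] by rewrite Els.
set w := walk_of ls.
have nthE m : (m < size ls)%N ->
    nth x0 w (erasure_time x0 w m) = nth x0 (unzip1 ls) m.
  move=> lt_m; have := cat_take_drop m ls; rewrite (drop_nth (x0, c0)) //.
  case: (nth _ ls m) (nth_map (x0, c0) x0 fst lt_m) => z c; rewrite /unzip1 => -> E.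
  have Em : size (take m ls) = m by rewrite size_take lt_m.
  move: (take m ls) (drop m.+1 ls) Em E => l1 l2 <- E; rewrite /w -E.
  by rewrite erasure_time_walk_of ?nth_block_end ?E.
have le_w : (size ls <= size w)%N.
  by rewrite /w; elim: (ls) => //= -[y d] l; rewrite /walk_of /= size_cat /=; lia.
have lastE : nth x0 w (size w).-1 = nth x0 (unzip1 ls) (size ls).-1.
  have : (0 < size ls)%N by rewrite Els.
  rewrite /w; case/lastP: (ls) fls => [//|l [z c]]; rewrite -cats1 => fl _.
  rewrite size_cat addn1 /unzip1 map_cat nth_cat size_map ltnn subnn /=.
  rewrite -[RHS](nth_block_end x0 fl) walk_of_cat size_cat /walk_of /= cats0 /=.
  by rewrite addnS.
(* The base points are distinct, so the last one is not reached earlier. *)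
have lenE : erasure_length x0 w = (size ls).-1.
  set k := (size ls).-1.
  have lt_k : (k < size ls)%N by rewrite /k Els.
  rewrite /erasure_length lastE -(subnKC (leq_trans lt_k le_w)) -addn1 -addnA iotaD.
  rewrite find_cat ifN; last first.
    apply/hasPn => m; rewrite mem_iota /= add0n => lt_mk.
    rewrite nthE ?(ltn_trans lt_mk) // nth_uniq ?size_map ?(forward_uniq fls) //.
      by rewrite neq_ltn lt_mk.
    exact: ltn_trans lt_mk lt_k.
  by rewrite size_iota add0n add1n /= nthE // eqxx addn0.
rewrite lenE prednK ?Els // -Els.
have -> : size ls = size (unzip1 ls) by rewrite size_map.
rewrite -[RHS](mkseq_nth x0); apply/eq_in_map => m; rewrite mem_iota size_map => lt_m.
exact: nthE.
Qed.

Definition reverse_loops ls : seq (X * seq X) :=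
  rev [seq (l.1, behead (rev (l.1 :: l.2))) | l <- ls].

Lemma unzip1_reverse_loops ls : unzip1 (reverse_loops ls) = rev (unzip1 ls).
Proof. by rewrite /unzip1 map_rev -map_comp. Qed.

Lemma rev_loop x c : last x c = x -> x :: behead (rev (x :: c)) = rev (x :: c).
Proof. by move=> lx; rewrite (lastI x c) rev_rcons lx. Qed.

(** A reversed loop has the same base point and visits the same points, and the
    loops that came later come first after reversal. *)
Lemma backward_reverse_loops A ls : backward A ls ->
  forward A (reverse_loops ls) /\ walk_of (reverse_loops ls) = rev (walk_of ls).
Proof.
elim: ls => //= -[x c] ls IHls /= /andP[/andP[/eqP lx av] /IHls[fls Els]].
have Erc : reverse_loops ((x, c) :: ls) =
    reverse_loops ls ++ [:: (x, behead (rev (x :: c)))].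
  by rewrite /reverse_loops /= rev_cons cats1.
split; rewrite Erc.
  rewrite forward_cat fls unzip1_reverse_loops revK /= andbT /loop_avoiding.
  rewrite rev_loop // /avoids all_rev -/(avoids _ _) av andbT -[last _ _]/(last x (x :: _)).
  by rewrite rev_loop // rev_cons last_rcons.
rewrite walk_of_cat Els /walk_of /= cats0 rev_loop // -cat_cons rev_cat.
by [].
Qed.

(** In a backward decomposition each loop ends right before the first visit of
    the next base point, so the path and its base points determine the loops. *)
Lemma backward_walk_inj ls ks : backward [::] ls -> backward [::] ks ->
  unzip1 ls = unzip1 ks -> walk_of ls = walk_of ks -> ls = ks.
Proof.
elim: ls ks => [|[x c] ls IHls] [|[x' d] ks] //= /andP[lc bls] /andP[ld bks].
case=> Ex Eu; subst x'; rewrite /walk_of /= -!/(walk_of _) => -[E].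
suff Ecd : c = d.
  by rewrite -Ecd; congr (_ :: _); apply: IHls => //; move: E; rewrite -Ecd => /eqP;
     rewrite eqseq_cat // eqxx => /eqP.
move: lc ld; rewrite /loop_avoiding !cats0 -Eu => /andP[_ /= /andP[_ avc]].
move=> /andP[_ /= /andP[_ avd]]; move: E avc avd Eu.
case: ls {bls IHls} ks {bks} => [|[y e] ls] [|[y' e'] ks] //=; first by rewrite !cats0.
rewrite /walk_of /= -!/(walk_of _) => E; rewrite !avoids_cons => /andP[yc _] /andP[yd _] [Ey _].
subst y'; have := congr1 (fun s => take (index y s) s) E.
by rewrite !index_cat (negPf yc) (negPf yd) /= eqxx !addn0 !take_size_cat.
Qed.

(** The map decomposes [p] at last visits, reorders the loops and concatenates
    the result, which is a decomposition at first visits with the same base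
    points; each of the three operations is injective on paths with the same loop
    erasure. *)
Theorem exists_reversing_rearrangement (eta : seq X) : exists phi : seq X -> seq X,
  (forall p, loop_erasure p = eta ->
     rearranged p (phi p) /\ loop_erasure (rev (phi p)) = rev eta) /\
  {in [pred p | loop_erasure p == eta] &, injective phi}.
Proof.
have [dec decP] := choice forward_decomposition.
have decE p : loop_erasure p = unzip1 (dec p).
  by case: (decP p) => fp {1}<-; apply: loop_erasure_walk_of.
exists (fun p => walk_of (reorder (dec p))); split=> [p|p q].
  rewrite decE; case: (decP p) => + Ep Eu; rewrite -{2}Ep.
  case: (dec p) Eu => [|[x c] ls]; first by move=> <- _.
  move=> Eu fls; have [Ed bd Pd] := reorderP fls; split.
    split; first by [].
    have := steps_walk_of (or_intror fls).
    case Er : (reorder ((x, c) :: ls)) Ed bd Pd => [//|[x' c'] ls'] [Ex Ed] bd Pd.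
    subst x'; move=> /permPl ->; rewrite perm_sym.
    rewrite (permPl (steps_walk_of (or_introl bd))).
    by rewrite Ed perm_cat2r perm_sym.
  have [frd <-] := backward_reverse_loops bd.
  by rewrite loop_erasure_walk_of // unzip1_reverse_loops Ed Eu.
rewrite !inE !decE => /eqP Ep /eqP Eq E.
have [[fp wp] [fq wq]] := (decP p, decP q).
have [[E1 b1 _] [E2 b2 _]] := (reorderP fp, reorderP fq).
rewrite -wp -wq; congr walk_of; apply: (reorder_inj fp fq); first by rewrite Ep.
by apply: backward_walk_inj => //; rewrite E1 E2 Ep.
Qed.

(** With at most one loop there is nothing to exchange. *)
Lemma loop_erasure_rev_small p : (size (loop_erasure p) <= 1)%N ->
  loop_erasure (rev p) = rev (loop_erasure p).
Proof.
have [ls [fls <-]] := forward_decomposition p; rewrite loop_erasure_walk_of // size_map.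
case: ls fls => [|l [|]] //= fls _.
have [frl <-] := @backward_reverse_loops [::] [:: l] fls.
by rewrite loop_erasure_walk_of.
Qed.

Definition unclosed p := exists a s, p = a :: s /\ last a s <> a.

Lemma loop_erasure_unclosed p : (1 < size (loop_erasure p))%N -> unclosed p.
Proof.
case: p => // a s Lp; exists a, s; split=> // la; move: Lp.
have -> : a :: s = walk_of [:: (a, s)] by rewrite /walk_of /= cats0.
rewrite loop_erasure_walk_of //= andbT /loop_avoiding la eqxx.
by apply/allP.
Qed.

End Decompositions.

(** * Segments and countable unions of events *)

Section Geometry.
Context {R : realType}.
Implicit Types (D : set (plane R)) (u v : plane R).

Lemma connected_segment u v : connected (segment u v).
Proof.
rewrite /segment; apply: connected_continuous_connected.
  exact: segment_connected.
apply: continuous_subspaceT => t.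
apply/cvgrPdist_lt => /= e e0.
have [e' e'0 Ee] : exists2 e' : R, 0 < e' & e = e'%:C%C.
  by move: e0; case: e => a b; rewrite ltcE /= => /andP[/eqP -> a0]; exists a.
pose M := Num.sqrt (complex.Re (v - u) ^+ 2 + complex.Im (v - u) ^+ 2).
have M0 : 0 < M + 1 by rewrite ltr_wpDl ?sqrtr_ge0.
near=> s.
rewrite opprD addrACA subrr add0r -mulrBl -rmorphB normrM.
rewrite [`|v - u|](normc_def (v - u)) -/M normc_def /= expr0n addr0 sqrtr_sqr.
rewrite -rmorphM Ee ltcR (@le_lt_trans _ _ (`|t - s| * (M + 1))) //.
  by rewrite ler_wpM2l // lerDl.
rewrite -ltr_pdivlMr //; near: s.
by exists (e' / (M + 1)); rewrite /= ?divr_gt0.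
Unshelve. all: by end_near.
Qed.

(** On a segment that avoids the boundary, [D] is both relatively open and
    relatively closed, because there [D] agrees with its closure. *)
Lemma segment_stays D u v : open D -> D u ->
  segment u v `&` boundary D = set0 -> D v.
Proof.
move=> oD Du E.
have Eseg : segment u v `&` D = segment u v.
  apply: (@connected_segment u v).
  - exists u; split=> //; exists 0; rewrite /= ?in_itv /= ?lexx ?ler01 //.
    by rewrite mul0r addr0.
  - by exists D.
  - exists (closure D); first exact: closed_closure.
    apply/seteqP; split=> z [sz Dz]; split=> //; first exact: subset_closure.
    apply: contrapT => nDz; suff : (segment u v `&` boundary D) z by rewrite E.
    split=> //; by split=> // /interior_subset.
have : segment u v v.
  exists 1; first by rewrite /= in_itv /= lexx ler01.
  by rewrite mul1r addrC subrK.
by rewrite -Eseg => -[].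
Qed.

End Geometry.

(** Both unions are countable and disjoint, so their measures can be compared term
    by term. Indices of null events may be left unmatched: this is how paths through pairs
    of weight zero, which the walk follows only with probability zero, are
    discarded. *)
Lemma measure_bigcup_le d (T : measurableType d) (R : realType)
    (P : {measure set T -> \bar R}) (I : Type) (A B : set I) (C : I -> set T)
    (e : I -> nat) (phi : I -> I) :
  (forall i j, (A `|` B) i -> (A `|` B) j -> e i = e j -> i = j) ->
  (forall i, (A `|` B) i -> measurable (C i)) ->
  (forall i j t, C i t -> C j t -> i = j) ->
  let A' := [set i | A i /\ P (C i) <> 0%E] in
  (forall i j, A' i -> A' j -> phi i = phi j -> i = j) ->
  (forall i, A' i -> B (phi i) /\ P (C (phi i)) = P (C i)) ->
  (P (\bigcup_(i in A) C i) <= P (\bigcup_(i in B) C i))%E.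
Proof.
move=> inje mC disjC A' injphi phiP.
pose F k := \bigcup_(i in [set i | A i /\ e i = k]) C i.
pose G k := \bigcup_(i in [set i | A' i /\ e i = k]) C (phi i).
have mB : measurable (\bigcup_(i in B) C i).
  have -> : \bigcup_(i in B) C i =
      \bigcup_k \bigcup_(i in [set i | B i /\ e i = k]) C i.
    apply/seteqP; split=> [t [i Bi Ci]|t [k _ [i [Bi _] Ci]]]; last by exists i.
    by exists (e i) => //; exists i.
  apply: bigcupT_measurable => k.
  have [[i Bi ei]|nB] := pselect (exists2 i, B i & e i = k).
    rewrite (_ : \bigcup_(_ in _) _ = C i); first by apply: mC; right.
    apply/seteqP; split=> [t [j [Bj ej]]|t Ct]; last by exists i.
    by rewrite (inje i j) ?ei ?ej //; right.
  rewrite (_ : \bigcup_(_ in _) _ = set0); first exact: measurable0.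
  by apply/seteqP; split=> // t [i [Bi ei] _]; case: nB; exists i.
have FE i : A i -> F (e i) = C i.
  move=> Ai; apply/seteqP; split=> [t [j [Aj E]]|t Ct]; first by rewrite (inje i j) //; left.
  by exists i.
have GE i : A' i -> G (e i) = C (phi i).
  move=> A'i; apply/seteqP; split=> [t [j [A'j E]]|t Ct].
    by rewrite (inje i j) //; left; [case: A'i | case: A'j].
  by exists i.
have F0 k : ~ (exists2 i, A i & e i = k) -> F k = set0.
  by move=> nk; apply/seteqP; split=> // t [i [Ai ei] _]; case: nk; exists i.
have G0 k : ~ (exists2 i, A' i & e i = k) -> G k = set0.
  by move=> nk; apply/seteqP; split=> // t [i [Ai ei] _]; case: nk; exists i.
have mF k : measurable (F k).
  have [[i Ai <-]|/F0 ->] := pselect (exists2 i, A i & e i = k); last exact: measurable0.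
  by rewrite FE //; apply: mC; left.
have mG k : measurable (G k).
  have [[i Ai <-]|/G0 ->] := pselect (exists2 i, A' i & e i = k); last exact: measurable0.
  by rewrite GE //; apply: mC; right; case: (phiP i).
have tF : trivIset setT F.
  apply/trivIsetP => k l _ _; apply: contra_neqP => /eqP/set0P[t [[i [_ <-] Ci] [j [_ <-] Cj]]].
  by rewrite (disjC _ _ _ Ci Cj).
have tG : trivIset setT G.
  apply/trivIsetP => k l _ _; apply: contra_neqP => /eqP/set0P[t [[i [Ai <-] Ci] [j [Aj <-] Cj]]].
  by rewrite (injphi _ _ Ai Aj (disjC _ _ _ Ci Cj)).
have -> : \bigcup_(i in A) C i = \bigcup_k F k.
  apply/seteqP; split=> [t [i Ai Ci]|t [k _ [i [Ai _] Ci]]]; last by exists i.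
  by exists (e i) => //; exists i.
have PFG k : P (F k) = P (G k).
  have [[i A'i <-]|nA'] := pselect (exists2 i, A' i & e i = k).
    by rewrite (GE _ A'i) (phiP _ A'i).2 FE //; case: A'i.
  rewrite (G0 _ nA') measure0.
  have [[i Ai ei]|/F0 ->] := pselect (exists2 i, A i & e i = k); last exact: measure0.
  by rewrite -ei FE //; apply: contrapT => nz; apply: nA'; exists i => //; split.
rewrite measure_bigcup //; under eq_eseriesr do rewrite PFG.
rewrite -measure_bigcup //; apply: le_measure.
- by rewrite inE; apply: bigcupT_measurable.
- by rewrite inE.
by move=> t [k _ [i [A'i _] Ci]]; exists (phi i) => //; case: (phiP _ A'i).
Qed.

(** * Paths of the walk up to its exit *)

Lemma inf_timeP (A : set nat) n :
  inf_time A = Some n <-> A n /\ (forall m, A m -> (n <= m)%N).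
Proof.
rewrite /inf_time; case: pselect => [h|nh]; last first.
  by split=> // -[An _]; case: nh; exists n; rewrite inE.
case: ex_minnP => m; rewrite inE => Am minm; split=> [[<-]|[An minn]].
  by split=> // k Ak; apply: minm; rewrite inE.
by congr Some; apply/eqP; rewrite eqn_leq minn // minm // inE.
Qed.

Lemma steps_mkseq (X : eqType) (g : nat -> X) n :
  steps (mkseq g n.+1) = mkseq (fun k => (g k, g k.+1)) n.
Proof. by elim: n => // n IHn; rewrite mkseqS mkseqS steps_rcons -mkseqS IHn -mkseqS. Qed.

Lemma rearranged_rcons (X : eqType) (q : seq X) b p' :
  rearranged (rcons q b) p' -> exists2 q', p' = rcons q' b & perm_eq q q'.
Proof.
case: p' => [|x' s'] H; first by case: H; case: q.
case: q H => [|x s] /rearranged_belast [_ _ /=].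
  by rewrite lastI => P <-; exists (belast x' s').
by rewrite lastI last_rcons belast_rcons => P <-; exists (belast x' s').
Qed.

Section StoppedPaths.
Context {R : realType}.
Variables (V : set (plane R)) (E : plane R -> plane R -> R) (D : set (plane R)).
Implicit Types (f : nat -> plane R) (p q : seq (walk_point R)).

(** When the walk starts outside [D], its first step is never an exit, since an
    exit edge starts in [D]; both cases of the exit time thus reduce to the first
    exit at a positive time. *)
Lemma exit_time_succ f n : exit_time V E D f = Some n.+1 <->
  [/\ (V `&` D) (f 0%N) \/ in_edge V E D (f 0%N) (f 1%N),
      out_edge V E D (f n) (f n.+1) &
      forall k, (k < n)%N -> ~ out_edge V E D (f k) (f k.+1)].
Proof.
rewrite /exit_time; case: ifPn => [|/negP]; rewrite inE => f0.
  rewrite inf_timeP /=; split=> [[[_ on] minn]|[_ on minn]].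
    split=> //; first by left.
    by move=> k lt_kn ok; have := minn k.+1 (conj isT ok); rewrite ltnS leqNgt lt_kn.
  split=> // -[|m] [// _ om]; rewrite ltnS leqNgt; apply/negP => lt_mn.
  exact: (minn _ lt_mn).
case: ifPn => /asboolP i01; last by split=> // -[[]].
rewrite inf_timeP /=; split=> [[[lt_n on] minn]|[_ on minn]].
  split=> //; first by right.
  move=> [|k] lt_kn ok; first by case: ok => _ /f0.
  by have := minn k.+2 (conj isT ok); rewrite ltnS leqNgt lt_kn.
split.
  by split=> //; case: n on {minn} => // -[_ /f0].
move=> [|m] [// _ om]; rewrite ltnS leqNgt; apply/negP => lt_mn.
exact: (minn _ lt_mn).
Qed.

Definition position (a : walk_point R) : plane R :=
  match a with inl z => z | inr z => z end.

Lemma position_exit_point z : position (exit_point V D z) = z.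
Proof. by rewrite /exit_point; case: ifP. Qed.

Definition stopped_point f n k : walk_point R :=
  if (k < n)%N then inl (f k) else exit_point V D (f n).

Lemma position_stopped_point f n k : (k <= n)%N ->
  position (stopped_point f n k) = f k.
Proof.
rewrite /stopped_point leq_eqVlt => /orP[/eqP ->|->] //.
by rewrite ltnn position_exit_point.
Qed.

Lemma stopped_walkE f n : stopped_walk V D f n = mkseq (stopped_point f n) n.+1.
Proof.
rewrite mkseqS /stopped_walk /stopped_point ltnn; congr rcons.
by apply/eq_in_map => k; rewrite mem_iota /= add0n => ->.
Qed.

Lemma position_stopped_walk f n :
  map position (stopped_walk V D f n) = mkseq f n.+1.
Proof.
rewrite stopped_walkE -map_comp; apply/eq_in_map => k; rewrite mem_iota add0n => lt_k.
exact: position_stopped_point.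
Qed.

(** The paths along edges from the start to a first exit at an end point other
    than the start. Except for the shape [rcons q b], whose end point [b] occurs
    only once, the conditions bear on single points and single steps, so that
    they depend only on the multiset of steps and on the initial point. The last
    alternative is the starting condition of the exit time when applied to the
    first step; at the later steps the walk is in [D]. *)
Definition exit_path p : Prop := exists q b,
  [/\ p = rcons q b, q <> [::] /\ b \notin q,
      (forall a, a \in q -> exists2 u, V u & a = inl u),
      V (position b) /\ b = exit_point V D (position b) &
      forall e, e \in steps p ->
        [/\ edge V E (position e.1) (position e.2),
            out_edge V E D (position e.1) (position e.2) <-> e.2 = b &
            (V `&` D) (position e.1) \/ in_edge V E D (position e.1) (position e.2)]].

Lemma exit_path_rearranged p p' :
  rearranged p p' -> exit_path p -> exit_path p'.
Proof.
move=> rpp' [q [b [Ep [q0 bq] qV Eb stp]]].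
have := rpp'; rewrite Ep => /rearranged_rcons[q' Ep' Pq].
exists q', b; split=> //.
- split; last by rewrite -(perm_mem Pq).
  by move=> Eq; move: Pq q0; rewrite Eq => /perm_nilP.
- by move=> a; rewrite -(perm_mem Pq); apply: qV.
- by move=> e; case: rpp' => _ /perm_mem <-; apply: stp.
Qed.

(** Before the exit, the walk stays in [D]: along an edge from a point of [D] that
    is not an exit edge, the segment does not meet the boundary. Hence the exit
    point can only coincide with the initial point, which is excluded. *)
Lemma stopped_walk_exit_path f n : open D -> (forall k, V (f k)) ->
  exit_time V E D f = Some n.+1 ->
  (forall k, (k <= n)%N -> edge V E (f k) (f k.+1)) ->
  inl (f 0%N) <> exit_point V D (f n.+1) ->
  exit_path (stopped_walk V D f n.+1).
Proof.
move=> oD fV /exit_time_succ[f0 on minn] fE neq0.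
have fD k : (0 < k <= n)%N -> D (f k).
  elim: k => // k IHk /andP[_ lt_kn].
  have [] : D (f k) \/ in_edge V E D (f k) (f k.+1).
  - case: k IHk lt_kn => [|k] IHk lt_kn; last by left; apply: IHk; rewrite /= ltnW.
    by case: f0 => [[_ ?]|?]; [left|right].
  - move=> Dk; apply: (segment_stays oD Dk); apply: contrapT => /eqP/set0P int.
    by apply: (minn k lt_kn); split=> //; exact: fE (ltnW lt_kn).
  - by case=> _ [].
have bf k : (k <= n)%N -> inl (f k) <> exit_point V D (f n.+1).
  case: k => [|k] // lt_kn; rewrite /exit_point.
  case: ifPn => // /negP nb [Ek]; apply: nb; rewrite -Ek inE; split=> //.
  exact: fD.
exists (map inl (mkseq f n.+1)), (exit_point V D (f n.+1)); split.
- by rewrite /stopped_walk -map_comp.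
- split=> //; apply/mapP => -[z /mapP[k]].
  by rewrite mem_iota add0n => /bf nk -> /esym.
- by move=> a /mapP[z /mapP[k _ ->] ->]; exists (f k).
- by rewrite position_exit_point.
move=> e; rewrite stopped_walkE steps_mkseq => /mapP[k]; rewrite mem_iota /= add0n.
move=> lt_kn ->; rewrite /= !position_stopped_point ?(ltnW lt_kn) //.
split; first exact: fE.
- move: lt_kn; rewrite ltnS leq_eqVlt => /orP[/eqP->|lt_kn].
    by rewrite /stopped_point ltnn.
  rewrite /stopped_point ltnS lt_kn; split=> [/(minn _ lt_kn)//|].
  by move/bf: lt_kn.
- case: k lt_kn => [|k] lt_kn; first exact: f0.
  by left; split=> //; apply: fD.
Qed.

Lemma exit_path_stopped f p : exit_path p ->
  map position p = mkseq f (size p) ->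
  exists n, exit_time V E D f = Some n.+1 /\ stopped_walk V D f n.+1 = p.
Proof.
case=> q [b [Ep [q0 bq] qV [bV Eb] stp]] Epos.
case Eq : (size q) q0 => [|n] q0; first by case: q Eq q0 {stp bq qV Ep}.
have Sp : size p = n.+2 by rewrite Ep size_rcons Eq.
have Es : stopped_walk V D f n.+1 = p.
  move: Epos; rewrite Sp mkseqS Ep map_rcons => /rcons_inj[Emq Emb].
  rewrite /stopped_walk -Emb -Eb; congr rcons.
  rewrite (map_comp inl f) -/(mkseq f n.+1) -Emq -map_comp -[RHS]map_id.
  by apply/eq_in_map => a /qV[u _ ->].
exists n; split=> //; apply/exit_time_succ.
have stk k : (k <= n)%N ->
    [/\ edge V E (f k) (f k.+1), out_edge V E D (f k) (f k.+1) <-> k = n &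
        (V `&` D) (f k) \/ in_edge V E D (f k) (f k.+1)].
  move=> le_kn; have := stp (stopped_point f n.+1 k, stopped_point f n.+1 k.+1).
  rewrite -Es stopped_walkE steps_mkseq /= !position_stopped_point ?(leqW le_kn) ?ltnS //.
  case.
    by apply/mapP; exists k; rewrite ?mem_iota.
  move=> ek ok ik; split=> //; rewrite ok.
  have Ebn : b = stopped_point f n.+1 n.+1.
    move: Es; rewrite stopped_walkE mkseqS Ep => /rcons_inj[_ <-//].
  split=> [Ekb|->]; last by rewrite Ebn.
  apply/eqP; rewrite eqn_leq le_kn leqNgt; apply/negP => lt_kn.
  case/negP: bq; move: Es; rewrite stopped_walkE mkseqS Ep => /rcons_inj[<- _].
  by rewrite -Ekb; apply/mapP; exists k.+1; rewrite ?mem_iota.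
split.
- by case: (stk 0%N).
- by case: (stk n (leqnn n)) => _ [_ H] _; apply: H.
- move=> k lt_kn; case: (stk k (ltnW lt_kn)) => _ [+ _] _ => /[apply] Ekn.
  by rewrite Ekn ltnn in lt_kn.
Qed.

End StoppedPaths.

(** * Probability of the paths of the stopped walk *)

Lemma steps_map (X Y : eqType) (g : X -> Y) (p : seq X) :
  steps (map g p) = [seq (g e.1, g e.2) | e <- steps p].
Proof. by case: p => // x s; elim: s x => //= y s IHs x; congr cons; apply: IHs. Qed.

Section WalkEvents.
Context {R : realType}.
Variables (V : set (plane R)) (E : plane R -> plane R -> R) (D : set (plane R)).
Context d (T : measurableType d) (P : probability T R).
Variables (x0 : plane R) (S : nat -> T -> plane R).
Hypothesis Gpi : planar_irreducible_graph V E.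
Hypothesis oD : open D.
Hypothesis walkS : natural_random_walk V E P x0 S.
Implicit Types (p : seq (walk_point R)).

Definition cylinder (s : seq (plane R)) : set T :=
  [set t | mkseq (S ^~ t) (size s) = s].

Lemma cylinderE y s n : size s = n.+1 ->
  cylinder s = [set t | forall k, (k <= n)%N -> S k t = nth y s k].
Proof.
move=> Ss; rewrite /cylinder Ss; apply/seteqP; split=> t /=.
  by move=> Es k le_kn; rewrite -Es nth_mkseq.
move=> Ht; apply: (@eq_from_nth _ y); rewrite ?size_mkseq ?Ss // => k lt_k.
by rewrite nth_mkseq //; apply: Ht.
Qed.

Lemma cylinder_rcons s z :
  cylinder (rcons s z) = cylinder s `&` [set t | S (size s) t = z].
Proof.
apply/seteqP; split=> t /=; rewrite /cylinder /= size_rcons mkseqS.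
  by move=> /rcons_inj[-> ->].
by case=> -> ->.
Qed.

Lemma measurable_cylinder s : measurable (cylinder s).
Proof.
elim/last_ind: s => [|s z IHs].
  by rewrite (_ : cylinder _ = setT) //; apply/seteqP; split.
by rewrite cylinder_rcons; apply: measurableI => //; apply: (walk_measurable walkS).
Qed.

Lemma cylinder_prob y s : (forall v, v \in y :: s -> V v) ->
  P (cylinder (y :: s)) =
  (P [set t | S 0%N t = y] * (\prod_(e <- steps (y :: s)) trans_prob V E e.1 e.2)%:E)%E.
Proof.
elim/last_ind: s => [|s z IHs] sV.
  rewrite big_nil mule1; congr (P _); rewrite (cylinderE y (n := 0)) //.
  apply/seteqP; split=> t /=; first by move=> /(_ 0%N); apply.
  by move=> Sy k; rewrite leqn0 => /eqP ->.
have sV' v : v \in y :: s -> V v.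
  by move=> vs; apply: sV; rewrite -rcons_cons mem_rcons inE vs orbT.
pose w k := nth y (y :: rcons s z) k.
have wV k : V (w k).
  rewrite /w; case: (ltnP k (size (y :: rcons s z))) => [lt_k|le_k].
    by apply: sV; apply: mem_nth.
  by rewrite nth_default //; apply: sV; rewrite mem_head.
have := walk_markov walkS (size s) wV.
have Sz : size (y :: rcons s z) = (size s).+2 by rewrite /= size_rcons.
rewrite -(cylinderE y Sz) => ->.
have -> : [set t | forall k, (k <= size s)%N -> S k t = w k] = cylinder (y :: s).
  rewrite (cylinderE y (n := size s)) //; apply/seteqP; split=> t /= H k le_k.
    by rewrite H // /w -rcons_cons nth_rcons /= ltnS le_k.
  by rewrite H // /w -rcons_cons nth_rcons /= ltnS le_k.
rewrite IHs // -muleA -EFinM; congr (_ * _%:E)%E.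
have -> : steps (y :: rcons s z) = rcons (steps (y :: s)) (last y s, z).
  by rewrite -rcons_cons (lastI y s) steps_rcons.
rewrite -cats1 big_cat big_seq1 /=; congr (_ * trans_prob V E _ _).
  by rewrite /w -rcons_cons nth_rcons ltnSn /= -last_nth.
by rewrite /w -rcons_cons nth_rcons ltnn eqxx.
Qed.

Definition stop_event p : set T :=
  [set t | exists n, exit_time V E D (S ^~ t) = Some n /\
                     stopped_walk V D (S ^~ t) n = p].

Lemma stop_event_sub p : stop_event p `<=` cylinder (map position p).
Proof.
move=> t [n [_ <-]]; rewrite /cylinder /= position_stopped_walk.
by rewrite size_mkseq.
Qed.

Lemma exit_time_local (f f' : nat -> plane R) n :
  (forall k, (k <= n.+1)%N -> f k = f' k) ->
  exit_time V E D f = Some n.+1 -> exit_time V E D f' = Some n.+1.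
Proof.
move=> ff' /exit_time_succ[f0 on minn]; apply/exit_time_succ; split.
- by rewrite -!ff'.
- by rewrite -!ff'.
- move=> k lt_kn; rewrite -!ff' //; first exact: minn.
  + exact: leq_trans lt_kn _.
  + exact: leq_trans (ltnW lt_kn) _.
Qed.

Lemma unclosed_exit f n p : unclosed p -> stopped_walk V D f n = p -> (0 < n)%N.
Proof. by case=> a [s [-> nl]]; case: n => // -[Ea Es]; case: nl; rewrite -Es. Qed.

(** A positive exit time only depends on the walk up to that time. Time zero is
    different, as it depends on the first step too; it only yields paths reduced
    to one point, which are closed. *)
Lemma stop_event_cylinder p : unclosed p -> stop_event p !=set0 ->
  stop_event p = cylinder (map position p).
Proof.
move=> op [t0 [n [ex0 E0]]]; have := unclosed_exit op E0.
case: n ex0 E0 => // n ex0 E0 _; apply/seteqP; split; first exact: stop_event_sub.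
move=> t /=; rewrite /cylinder /= size_map -E0 position_stopped_walk.
rewrite stopped_walkE size_mkseq => Et.
have ff' k : (k <= n.+1)%N -> S k t0 = S k t.
  move=> le_k; have := congr1 (fun s => nth (S k t) s k) Et.
  by rewrite !nth_mkseq.
exists n.+1; split; first exact: exit_time_local ff' ex0.
rewrite stopped_walkE; apply/eq_in_map => k; rewrite mem_iota /= add0n ltnS => le_k.
by rewrite /stopped_point !ff'.
Qed.

Lemma measurable_stop_event p : unclosed p -> measurable (stop_event p).
Proof.
move=> op; have [->|/set0P ne] := eqVneq (stop_event p) set0; first exact: measurable0.
by rewrite stop_event_cylinder //; apply: measurable_cylinder.
Qed.

Lemma stop_event_of_exit_path p : exit_path V E D p ->
  stop_event p = cylinder (map position p).
Proof.
move=> cp; apply/seteqP; split; first exact: stop_event_sub.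
move=> t; rewrite /cylinder /= size_map => Et.
by have [n Hn] := exit_path_stopped cp (esym Et); exists n.+1.
Qed.

(** A step along a pair that is not an edge makes the probability vanish. *)
Lemma stop_event_exit_path p : unclosed p -> P (stop_event p) <> 0%E ->
  exit_path V E D p.
Proof.
move=> op Pp; have ne : stop_event p !=set0.
  by apply/set0P; apply: contra_notN Pp => /eqP ->; rewrite measure0.
have [t0 [n [ex0 E0]]] := ne; have := unclosed_exit op E0.
case: n ex0 E0 => // n ex0 E0 _.
move: Pp; rewrite stop_event_cylinder // -E0 position_stopped_walk => Pp.
apply: stopped_walk_exit_path => //; first by move=> k; apply: (walk_vertex walkS).
- move=> k le_kn; split; [exact: (walk_vertex walkS)|exact: (walk_vertex walkS)|].
  rewrite lt_neqAle (weight_ge0 Gpi) ?andbT; [|exact: (walk_vertex walkS)..].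
  apply/eqP => E0'; apply: Pp.
  have [y [r Emk]] : exists y r, mkseq (S ^~ t0) n.+2 = y :: r by do 2!eexists.
  rewrite Emk cylinder_prob -?Emk; last first.
    by move=> v /mapP[j _ ->]; apply: (walk_vertex walkS).
  rewrite steps_mkseq.
  rewrite (big_rem (S k t0, S k.+1 t0)) /=; last first.
    by apply/mapP; exists k; rewrite ?mem_iota.
  by rewrite {1}/trans_prob -E0' !mul0r mule0.
case: op E0 => a [s [-> nl]] /= [Ea Es] Eend; apply: nl.
by rewrite -Es last_rcons -Ea -Eend.
Qed.

Lemma stop_event_rearranged p p' : exit_path V E D p -> rearranged p p' ->
  P (stop_event p') = P (stop_event p).
Proof.
move=> cp rpp'; have cp' := exit_path_rearranged rpp' cp.
have posV q : exit_path V E D q -> forall v, v \in map position q -> V v.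
  move=> [r [b [-> _ rV [bV _] _]]] v /mapP[a + ->].
  by rewrite mem_rcons inE => /orP[/eqP->//|/rV[u uV ->]].
rewrite !stop_event_of_exit_path //.
have := rpp'; case=> Eh Ps; move: (posV _ cp) (posV _ cp').
have {}Ps : perm_eq (steps (map position p)) (steps (map position p')).
  by rewrite !steps_map perm_map.
case: p p' Eh Ps {cp cp' rpp'} => [|a s] [|a' s'] //= [<-] Ps pV pV'.
rewrite !cylinder_prob //; congr (_ * _%:E)%E.
by rewrite (perm_big _ Ps).
Qed.

Lemma countable_paths : exists e : seq (walk_point R) -> nat,
  forall p q, (forall a, a \in p -> V (position a)) ->
    (forall a, a \in q -> V (position a)) -> e p = e q -> p = q.
Proof.
have /countable_injP[h injh] := vertices_countable Gpi.
pose g (a : walk_point R) := (if a is inl _ then true else false, h (position a)).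
have injg a b : V (position a) -> V (position b) -> g a = g b -> a = b.
  move=> Va Vb [] + /injh; rewrite !inE => + /(_ Va Vb).
  by case: a b {Va Vb} => [z|z] [z'|z'] //= _ ->.
exists (fun p => pickle (map g p)) => p q pV qV /(pcan_inj pickleK).
elim: p q pV qV => [|a p IHp] [|b q] // pV qV /= Eab.
have Ea : a = b.
  by apply: injg; [apply: pV|apply: qV|case: Eab => *; congr (_, _)]; rewrite ?mem_head.
rewrite Ea; congr (_ :: _); apply: IHp.
- by move=> c pc; apply: pV; rewrite inE pc orbT.
- by move=> c qc; apply: qV; rewrite inE qc orbT.
- by case: Eab.
Qed.

Lemma stop_events_le (A B : set (seq (walk_point R))) phi :
  (forall p, (A `|` B) p -> unclosed p) ->
  (forall p q, A p -> A q -> phi p = phi q -> p = q) ->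
  (forall p, A p -> rearranged p (phi p) /\ B (phi p)) ->
  (P (\bigcup_(p in A) stop_event p) <= P (\bigcup_(p in B) stop_event p))%E.
Proof.
move=> opAB injphi phiP; have [e injE] := countable_paths.
pose inV p := forall a, a \in p -> V (position a).
have inVE C : \bigcup_(p in C) stop_event p = \bigcup_(p in C `&` inV) stop_event p.
  apply/seteqP; split=> t [p]; last by case=> Cp _ ep; exists p.
  move=> Cp ep; exists p => //; split=> // a pa.
  have := stop_event_sub ep; rewrite /cylinder /= => Et.
  have : position a \in map position p by apply: map_f.
  by rewrite -Et => /mapP[k _ ->]; apply: (walk_vertex walkS).
rewrite [X in (P X <= _)%E]inVE [X in (_ <= P X)%E]inVE.
apply: (measure_bigcup_le (e := e) (phi := phi)).
- by move=> p q [[_ pV]|[_ pV]] [[_ qV]|[_ qV]]; apply: injE.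
- by move=> p [[Ap _]|[Bp _]]; apply: measurable_stop_event; apply: opAB; [left|right].
- by move=> p q t [n [en <-]] [m [em <-]]; move: em; rewrite en => -[->].
- by move=> p q [[Ap _] _] [[Aq _] _]; apply: injphi.
move=> p [[Ap pV] Pp]; have [rp Bp] := phiP p Ap.
have cp : exit_path V E D p by apply: stop_event_exit_path => //; apply: opAB; left.
split; last exact: stop_event_rearranged.
split=> // a pa; have [q [b [Ep _ qV [bV _] _]]] := exit_path_rearranged rp cp.
by move: pa; rewrite Ep mem_rcons inE => /orP[/eqP->//|/qV[u uV ->]].
Qed.

End WalkEvents.

(** * Reversing the stopped walk *)

Theorem proposition4p1 (R : realType)
    (V : set (plane R)) (E : plane R -> plane R -> R) (D : set (plane R))
    (d : measure_display) (T : measurableType d) (P : probability T R)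
    (x : plane R) (S : nat -> T -> plane R) :
  planar_irreducible_graph V E ->
  simply_connected_domain D -> D <> setT ->
  V x -> natural_random_walk V E P x S ->
  forall omega : seq (walk_point R),
    P [set t | exists n, exit_time V E D (S ^~ t) = Some n /\
         loop_erasure (rev (stopped_walk V D (S ^~ t) n)) = omega] =
    P [set t | exists n, exit_time V E D (S ^~ t) = Some n /\
         rev (loop_erasure (stopped_walk V D (S ^~ t) n)) = omega].
Proof.
move=> Gpi [[oD _ _] _] _ _ walkS omega.
pose A := [set p : seq (walk_point R) | loop_erasure (rev p) = omega].
pose B := [set p : seq (walk_point R) | rev (loop_erasure p) = omega].
have eventE C : [set t | exists n, exit_time V E D (S ^~ t) = Some n /\
      C (stopped_walk V D (S ^~ t) n)] = \bigcup_(p in C) stop_event V E D S p.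
  apply/seteqP; split=> t /=.
    by move=> [n [en Cp]]; exists (stopped_walk V D (S ^~ t) n) => //; exists n.
  by move=> [p Cp [n [en Ep]]]; exists n; rewrite Ep.
rewrite (eventE A) (eventE B).
have [small|large] := leqP (size omega) 1%N.
  suff -> : A = B by [].
  apply/seteqP; split=> p; rewrite /A /B /= => Ep.
    by rewrite -[p]revK loop_erasure_rev_small ?Ep // revK.
  by rewrite loop_erasure_rev_small // -(size_rev (loop_erasure p)) Ep.
have unclosedB p : B p -> unclosed p.
  by move=> Bp; apply: loop_erasure_unclosed; rewrite -size_rev Bp.
have unclosedA p : A p -> unclosed p.
  move=> Ap; apply: loop_erasure_unclosed; rewrite ltnNge; apply/negP => Lp.
  by have := loop_erasure_rev_small Lp; rewrite Ap => Er;
     rewrite Er size_rev ltnNge Lp in large.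
have [phi [phiP phi_inj]] := exists_reversing_rearrangement (rev omega).
have [psi [psiP psi_inj]] := exists_reversing_rearrangement omega.
apply/eqP; rewrite eq_le; apply/andP; split.
- apply: (stop_events_le Gpi oD walkS (phi := rev \o psi \o rev)).
  + by move=> p [/unclosedA|/unclosedB].
  + move=> p q Ap Aq /= /(can_inj revK) /psi_inj /= E'.
    by apply: (can_inj revK); apply: E'; rewrite inE; apply/eqP.
  + move=> p Ap /=; have [rp Er] := psiP _ Ap; split.
      by rewrite -[X in rearranged X _]revK; apply: rearranged_rev.
    by rewrite /B /= Er revK.
- apply: (stop_events_le Gpi oD walkS (phi := phi)).
  + by move=> p [/unclosedB|/unclosedA].
  + move=> p q Bp Bq /phi_inj E'.
    by apply: E'; rewrite inE; apply/eqP; apply: (can_inj revK); rewrite revK.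
  + move=> p Bp; have [|rp Er] := phiP p; first by rewrite -Bp revK.
    by split=> //; rewrite /A /= Er revK.
Qed.
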